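(* Let $S_1,\dots,S_m\subseteq[n]$ be sets with $m\le n$, let $k\le m$ be an integer, and for each $i\in[n]$ let $f_i=|\{j: i\in S_j\}|$ be the frequency of $i$, where every element lies in at least one set (so $f_i\ge1$). Let $\mathrm{Opt}$ be the maximum number of elements covered by the union of $k$ of the sets. Work in the MPC model in which there are $m$ machines each with $\tilde O(n)$ memory, machine $j$ initially holds $S_j$, and in each round machines exchange messages with no machine receiving more than $\tilde O(n)$ total. Then for $\epsilon\in(0,1)$ there is an algorithm that finds $\mathbf{x}\in[0,1]^n$ and $\mathbf{z}\in[0,1]^m$ such that (1) $\sum_{i\in[n]}x_i\ge(1-\epsilon)\mathrm{Opt}$; (2) $\sum_{j\in[m]}z_j=m-k$; (3) $\frac{x_i}{f_i}+\frac{1}{f_i}\sum_{j:\,S_j\ni i}z_j\le 1+\epsilon$ for all $i\in[n]$, in $O(\epsilon^{-3}\log n\cdot\log m)$ rounds.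
   Context: $\tilde O(\cdot)$ hides polylogarithmic factors. *)

(* Defs.v *)
From HB Require Import structures.
From mathcomp Require Import all_boot all_order all_algebra.
From mathcomp Require Import reals exp.

Set Implicit Arguments.
Unset Strict Implicit.
Unset Printing Implicit Defensive.

Import Order.TTheory GRing.Theory Num.Theory.
Local Open Scope ring_scope.

Section Coverage.
Variables n m : nat.
Implicit Type S : 'I_m -> {set 'I_n}.

Definition frequency S (i : 'I_n) : nat := #|[set j | i \in S j]|.

(* Meaningful for k <= m, when there are index sets K of cardinality k. *)
Definition opt_coverage S (k : nat) : nat :=
  \max_(K : {set 'I_m} | #|K| == k) #|\bigcup_(j in K) S j|.

End Coverage.

(* A deterministic synchronous message-passing program for m machines. All data
   stored or exchanged are bit strings; local computation is unrestricted, as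
   usual in the MPC model, and the round number is known to every machine.
   - [send t j s l] is the message sent in round t by machine j, with memory s,
     to machine l (the empty string means that nothing is sent);
   - [update t j s inbox] is the memory of machine j after round t, [inbox l]
     being the message it received from machine l;
   - the output is distributed over the machines: [report_x j s i] is the value
     that machine j, with final memory s, reports for the coordinate x_i, or
     [None] if j does not report x_i; likewise for [report_z] and z. *)
Record mpc_algorithm (R : realType) (n m : nat) := MPCAlgorithm {
  rounds : nat;
  send : nat -> 'I_m -> seq bool -> 'I_m -> seq bool;
  update : nat -> 'I_m -> seq bool -> ('I_m -> seq bool) -> seq bool;
  report_x : 'I_m -> seq bool -> 'I_n -> option R;
  report_z : 'I_m -> seq bool -> 'I_m -> option R }.

Section Execution.
Variables (R : realType) (n m : nat).
Variables (A : mpc_algorithm R n m) (S : 'I_m -> {set 'I_n}).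

(* Machine j starts with the characteristic bit vector of S_j and nothing
   else. *)
Fixpoint memory (t : nat) : 'I_m -> seq bool :=
  if t is t'.+1 then
    fun j => update A t' j (memory t' j) (fun l => send A t' l (memory t' l) j)
  else fun j => [seq i \in S j | i <- enum 'I_n].

Definition received (t : nat) (j : 'I_m) : nat :=
  (\sum_(l < m) size (send A t l (memory t l) j))%N.

Definition respects_capacity (B : R) : Prop :=
  (forall t j, (t <= rounds A)%N -> (size (memory t j))%:R <= B) /\
  (forall t j, (t < rounds A)%N -> (received t j)%:R <= B).

(* Every coordinate is reported by at least one machine, and all the reported
   values are those of x and z. *)
Definition outputs (x : 'rV[R]_n) (z : 'rV[R]_m) : Prop :=
  let final := memory (rounds A) in
  [/\ forall i, exists j, report_x A j (final j) i = Some (x 0 i),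
      forall j i v, report_x A j (final j) i = Some v -> v = x 0 i,
      forall i, exists j, report_z A j (final j) i = Some (z 0 i)
    & forall j i v, report_z A j (final j) i = Some v -> v = z 0 i].

End Execution.

(* The number of bits in C * n * (log (2n))^c words of log (2n / eps) bits each,
   i.e. \tilde O(n) words, a word being able to hold an index or a number of
   precision polynomial in eps / n. The factor 2 only keeps the logarithms
   positive when n = 1. *)
Definition capacity (R : realType) (C : R) (c n : nat) (eps : R) : R :=
  C * n%:R * ln (2 * n%:R) ^+ c * ln (2 * n%:R / eps).

(* Main.v *)
(* Multiplicative weights with the n constraints (3) as experts. Divided by f_i,
   one step loads a constraint by at most 2, so O(eps^-2 log n) iterations
   suffice. The response to the prices is a pair (X, Z) of index sets with
   |Z| = m - k, total price at most 1 and |X| maximal; since an optimal cover,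
   together with the m - k unused sets, is affordable, |X| >= Opt without Opt
   being known. Averaging the responses gives x and z, and this uses only
   counters.
   In the MPC model, machine l first receives the rows of the incidence matrix
   of the elements i = l mod m, about n / m rows of m bits. Each iteration then
   takes two rounds: the owners broadcast the loads of their elements, and every
   machine broadcasts the rounded price of its set; all machines then compute
   the same response. *)
Require Import Defs.
From HB Require Import structures.
From mathcomp Require Import all_boot all_order all_algebra.
From mathcomp Require Import boolp reals sequences exp.
From mathcomp Require Import zify ring lra.

Set Implicit Arguments.
Unset Strict Implicit.
Unset Printing Implicit Defensive.

Import Order.TTheory GRing.Theory Num.Theory.
Local Open Scope ring_scope.

(** * Multiplicative weights *)

(** Since [1 - u <= expR (- u)], one has [expR u <= 1 / (1 - u)], and [(1 - u) * (1 + u + 2 u^2) = 1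
    + u^2 (1 - 2u)] is at least 1 for [u <= 1/2]. *)
Lemma expR_le_quadratic (R : realType) (u : R) :
  0 <= u <= 1 / 2 -> expR u <= 1 + u + 2 * u ^+ 2.
Proof.
move=> /andP[u_ge0 u_le]; have gt0 : 0 < 1 - u by lra.
have : 1 - u <= expR (- u) by apply: expR_ge1Dx.
rewrite expRN -[leLHS]invrK lef_pV2 ?posrE ?expR_gt0 ?invr_gt0 // => /le_trans.
apply; rewrite invf_ple ?posrE //; last nra.
by rewrite -div1r ler_pdivrMr //; nra.
Qed.

Lemma sum_mem (T : finType) (A : {set T}) :
  (\sum_(a : T) (a \in A) = #|A|)%N.
Proof.
rewrite -sum1_card [RHS]big_mkcond; apply: eq_bigr => a _.
by case: (a \in A).
Qed.

Section MultiplicativeWeights.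
Variables (R : realType) (n m k E : nat).
Implicit Types (f load : 'I_n -> nat) (s : 'I_m -> nat).

Definition eta : R := (16 * E)%:R^-1.
(** Rounding [m] scores down to multiples of [1 / score_scale] loses at most
    [m / score_scale = 2 * eta] in all. *)
Definition score_scale : nat := 8 * m * E.

Definition weight f load i : R := expR (eta * ((load i)%:R / (f i)%:R)).
Definition potential f load : R := \sum_i weight f load i.
(** Normalised so that prices times frequencies sum to 1, which is the budget in [affordable]. *)
Definition price f load i : R := weight f load i / (f i)%:R / potential f load.

Definition score f load (D : {set 'I_n}) : nat :=
  Num.trunc (score_scale%:R * \sum_(i in D) price f load i).

Definition affordable f load s (w : {set 'I_n} * {set 'I_m}) : bool :=
  (#|w.2| == m - k)%N &&
  (\sum_(i in w.1) price f load i
   + (\sum_(j in w.2) s j)%:R / score_scale%:R <= 1).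

(** A function of loads, frequencies and scores only, so machines that share these data agree on the
    response without communicating it. *)
Definition best_response f load s : {set 'I_n} * {set 'I_m} :=
  [arg max_(w > (set0, [set j : 'I_m | (j < m - k)%N])
           | affordable f load s w) #|w.1|].

Variable S : 'I_m -> {set 'I_n}.

Definition set_load s i : nat := \sum_(j | i \in S j) s j.

(** Divided by the number of iterations and by the frequency of [i], this is the left-hand side of
    constraint (3). *)
Definition total_load (c : ('I_n -> nat) * ('I_m -> nat)) i : nat :=
  (c.1 i + set_load c.2 i)%N.

Definition response (c : ('I_n -> nat) * ('I_m -> nat)) :=
  best_response (frequency S) (total_load c)
    (fun j => score (frequency S) (total_load c) (S j)).

Definition step (c : ('I_n -> nat) * ('I_m -> nat)) :=
  (fun i => c.1 i + (i \in (response c).1),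
   fun j => c.2 j + (j \in (response c).2))%N.

Definition counts t := iter t step (fun=> 0%N, fun=> 0%N).

Hypotheses (n_gt0 : (0 < n)%N) (m_gt0 : (0 < m)%N) (E_gt0 : (0 < E)%N).
Hypothesis freq_gt0 : forall i, (0 < frequency S i)%N.

Local Notation price_of c := (price (frequency S) (total_load c)).
Local Notation pot c := (potential (frequency S) (total_load c)).
Local Notation scr c j := (score (frequency S) (total_load c) (S j)).

(** * Prices and their rounded scores *)

Lemma weight_gt0 f load i : 0 < weight f load i.
Proof. exact: expR_gt0. Qed.

Lemma weight_le_potential f load i : weight f load i <= potential f load.
Proof.
rewrite /potential (bigD1 i) //= lerDl sumr_ge0 // => j _.
exact/ltW/weight_gt0.
Qed.

Lemma potential_gt0 f load : 0 < potential f load.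
Proof.
exact: lt_le_trans (weight_gt0 _ _ _)
  (weight_le_potential f load (Ordinal n_gt0)).
Qed.

Lemma price_ge0 f load i : 0 <= price f load i.
Proof. by rewrite !divr_ge0 // ltW ?weight_gt0 ?potential_gt0. Qed.

Lemma score_scale_gt0 : (0 : R) < score_scale%:R.
Proof. by rewrite ltr0n !muln_gt0 m_gt0. Qed.

Lemma sum_prices_by_sets (a : 'I_n -> R) (Z : {set 'I_m}) :
  \sum_(j in Z) \sum_(i in S j) a i
  = \sum_i a i * (set_load (fun j => j \in Z) i)%:R.
Proof.
under eq_bigr do rewrite big_mkcond.
rewrite exchange_big /=; apply: eq_bigr => i _.
rewrite natr_sum mulr_sumr big_mkcond [RHS]big_mkcond /=.
by apply: eq_bigr => j _; case: (j \in Z); case: ifP; rewrite ?mulr1 ?mulr0.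
Qed.

Lemma set_load_le_frequency (Z : {set 'I_m}) i :
  (set_load (fun j => j \in Z) i <= frequency S i)%N.
Proof.
rewrite /frequency -sum1_card /set_load.
under [leqRHS]eq_bigl => j do rewrite inE.
by apply: leq_sum => j _; case: (j \in Z).
Qed.

Lemma sum_price_frequency c : \sum_i price_of c i * (frequency S i)%:R = 1.
Proof.
have P_neq0 : pot c != 0 by rewrite gt_eqF ?potential_gt0.
rewrite -[RHS](divff P_neq0) {2}/potential mulr_suml; apply: eq_bigr => i _.
by rewrite /price mulrAC divfK // pnatr_eq0 -lt0n.
Qed.

Lemma score_le c j :
  (scr c j)%:R / score_scale%:R <= \sum_(i in S j) price_of c i.
Proof.
rewrite ler_pdivrMr ?score_scale_gt0 // [leRHS]mulrC truncn_le.
by rewrite mulr_ge0 // sumr_ge0 // => i _; apply: price_ge0.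
Qed.

Lemma score_gt c j :
  \sum_(i in S j) price_of c i <= ((scr c j)%:R + 1) / score_scale%:R.
Proof.
by rewrite ler_pdivlMr ?score_scale_gt0 // mulrC natr1 ltW // truncnS_gt.
Qed.

(** Guarantees that scores fit in a word: as frequencies are at least 1, the prices within one set
    sum to at most 1. *)
Lemma score_le_scale c j : (scr c j <= score_scale)%N.
Proof.
rewrite -(ler_nat R) -[leRHS]mul1r -ler_pdivrMr ?score_scale_gt0 //.
apply: le_trans (score_le c j) _; rewrite -[leRHS](sum_price_frequency c).
rewrite big_mkcond; apply: ler_sum => i _; case: ifP => _.
  by rewrite ler_peMr ?price_ge0 // ler1n.
by rewrite mulr_ge0 ?price_ge0.
Qed.

(** * Affordable responses and comparison with the optimum *)

Lemma affordable_if c (X : {set 'I_n}) (Z : {set 'I_m}) :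
  #|Z| = (m - k)%N ->
  (forall i, ((i \in X) + set_load (fun j => j \in Z) i <= frequency S i)%N) ->
  affordable (frequency S) (total_load c) (fun j => scr c j) (X, Z).
Proof.
move=> cardZ XZ; rewrite /affordable /= cardZ eqxx /= natr_sum mulr_suml.
(* With the budget 1 written as the sum of prices times frequencies, the comparison becomes
   termwise; rounding the scores down only helps. *)
rewrite -[leRHS](sum_price_frequency c).
apply: (@le_trans _ _ (\sum_(i in X) price_of c i
  + \sum_(j in Z) \sum_(i in S j) price_of c i)).
  by rewrite lerD2l ler_sum // => j _; apply: score_le.
rewrite sum_prices_by_sets big_mkcond -big_split /=.
apply: ler_sum => i _; have -> : (if i \in X then price_of c i else 0)
  = price_of c i * (i \in X)%:R by case: (i \in X); rewrite ?mulr1 ?mulr0.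
by rewrite -mulrDr -natrD ler_wpM2l ?price_ge0 // ler_nat.
Qed.

Lemma responseP c :
  affordable (frequency S) (total_load c) (fun j => scr c j) (response c) /\
  forall w, affordable (frequency S) (total_load c) (fun j => scr c j) w ->
    (#|w.1| <= #|(response c).1|)%N.
Proof.
rewrite /response /best_response.
case: arg_maxnP => [|w ? wP]; last by split=> // w' /wP.
(* The default of [arg max] has to be affordable itself: with no element chosen, any [m - k] sets
   load [i] by at most its frequency. *)
apply: affordable_if => [|i]; last by rewrite inE add0n set_load_le_frequency.
rewrite -sum1_card (eq_bigl (fun j : 'I_m => j < m - k)%N) => [|j];
  last by rewrite inE.
by rewrite (big_ord_narrow (leq_subr k m)) sum1_card card_ord.
Qed.

Lemma card_response2 c : #|(response c).2| = (m - k)%N.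
Proof. by have [/andP[/eqP]] := responseP c. Qed.

(** The competitor is the union of [K] paired with [~: K]. A covered element lies in some set of
    [K], so at most its frequency minus one sets of [~: K] contain it. *)
Lemma opt_le_response c : (opt_coverage S k <= #|(response c).1|)%N.
Proof.
apply/bigmax_leqP => K /eqP cardK; have [_ best] := responseP c.
apply: (best (\bigcup_(j in K) S j, ~: K)); apply: affordable_if.
  by rewrite cardsCs setCK card_ord cardK.
move=> i; case: bigcupP => [[j jK iSj]|_]; last first.
  exact: set_load_le_frequency.
rewrite add1n /frequency -sum1_card /set_load.
under [ltnRHS]eq_bigl => l do rewrite inE.
rewrite (bigD1 j) //= [ltnRHS](bigD1 j) //= inE jK add0n add1n ltnS.
by apply: leq_sum => l _; case: (l \in _).
Qed.

(** * Growth of the potential and the resulting load bound *)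

Definition increment c i : nat :=
  ((i \in (response c).1) + set_load (fun j => j \in (response c).2) i)%N.

Lemma total_load_step c i :
  total_load (step c) i = (total_load c i + increment c i)%N.
Proof. by rewrite /total_load /increment /set_load /= big_split addnACA. Qed.

(* The rounding of the scores costs at most [m] units of [1 / score_scale]. *)
Lemma increment_cost c :
  \sum_i price_of c i * (increment c i)%:R <= 1 + 2 * eta.
Proof.
have [/andP[_ cost] _] := responseP c; rewrite natr_sum mulr_suml in cost.
under eq_bigr => i do rewrite natrD mulrDr.
rewrite big_split -sum_prices_by_sets /=.
have -> : \sum_i price_of c i * (i \in (response c).1)%:R
          = \sum_(i in (response c).1) price_of c i.
  rewrite [RHS]big_mkcond; apply: eq_bigr => i _.
  by case: (i \in _); rewrite ?mulr1 ?mulr0.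
suff rounding : \sum_(j in (response c).2) \sum_(i in S j) price_of c i
    <= \sum_(j in (response c).2) (scr c j)%:R / score_scale%:R + 2 * eta.
  by move: cost rounding; lra.
have -> : 2 * eta = \sum_(j < m) score_scale%:R^-1.
  rewrite sumr_const card_ord /eta /score_scale !natrM -[RHS]mulr_natr.
  by field; rewrite !pnatr_eq0 -!lt0n E_gt0.
rewrite [\sum_(j < m) _](bigID (mem (response c).2)) /= addrA -big_split /=.
apply: ler_wpDr.
  by rewrite sumr_ge0 // => j _; rewrite invr_ge0 ltW ?score_scale_gt0.
apply: ler_sum => j _; apply: le_trans (score_gt c j) _.
by rewrite mulrDl mul1r.
Qed.

(** The width of the method: it keeps the exponents in [weight_step] below [2 * eta], where the
    quadratic bound on [expR] applies. *)
Lemma increment_le c i : (increment c i <= 2 * frequency S i)%N.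
Proof.
rewrite mul2n -addnn leq_add ?set_load_le_frequency //.
exact: leq_trans (leq_b1 _) (freq_gt0 i).
Qed.

Lemma eta_gt0 : 0 < eta.
Proof. by rewrite invr_gt0 ltr0n muln_gt0. Qed.

Lemma eta_le : eta <= 1 / 16.
Proof.
rewrite /eta natrM invfM div1r ler_piMr ?invr_ge0 // invf_le1 ?ltr0n //.
by rewrite ler1n.
Qed.

(** The relative increment [l] is at most 2, so the second-order term [2 (eta l)^2] is at most
    [4 eta^2 l], linear in [l]. *)
Lemma weight_step c i :
  weight (frequency S) (total_load (step c)) i
  <= weight (frequency S) (total_load c) i
     * (1 + eta * (1 + 4 * eta) * ((increment c i)%:R / (frequency S i)%:R)).
Proof.
rewrite /weight total_load_step natrD mulrDl mulrDr expRD.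
rewrite ler_pM2l ?expR_gt0 //.
have eta0 := eta_gt0; have eta1 := eta_le.
set l := (increment c i)%:R / _.
have l_ge0 : 0 <= l by rewrite divr_ge0.
have l_le2 : l <= 2.
  by rewrite ler_pdivrMr ?ltr0n // -natrM ler_nat increment_le.
apply: le_trans (expR_le_quadratic _) _; first by apply/andP; split; nra.
have -> : 1 + eta * l + 2 * (eta * l) ^+ 2
  = 1 + eta * (1 + 2 * eta * l) * l by ring.
rewrite lerD2l ler_wpM2r // ler_pM2l // lerD2l.
by nra.
Qed.

(** Summing [weight_step] turns the increments into their cost, at most [1 + 2 eta]; then
    [(1 + 4 eta)(1 + 2 eta) <= 1 + 7 eta] because [eta <= 1/16]. *)
Lemma potential_step c : pot (step c) <= pot c * expR (eta * (1 + 7 * eta)).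
Proof.
have eta0 := eta_gt0; have eta1 := eta_le.
have P0 := potential_gt0 (frequency S) (total_load c).
apply: (@le_trans _ _ (pot c * (1 + eta * (1 + 4 * eta)
    * \sum_i price_of c i * (increment c i)%:R))).
  rewrite mulrDr mulr1 mulrA mulr_sumr.
  rewrite [X in _ <= X + _]/potential -big_split /=.
  apply: ler_sum => i _; apply: le_trans (weight_step c i) _.
  rewrite le_eqVlt; apply/orP; left; apply/eqP.
  rewrite /price; field.
  by rewrite gt_eqF // pnatr_eq0 -lt0n freq_gt0.
rewrite ler_pM2l //; apply: le_trans (expR_ge1Dx _).
rewrite lerD2l -mulrA ler_pM2l //.
apply: le_trans (ler_wpM2l _ (increment_cost c)) _; first by nra.
by nra.
Qed.

Lemma potential_counts t :
  pot (counts t) <= n%:R * expR (t%:R * (eta * (1 + 7 * eta))).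
Proof.
elim: t => [|t IHt].
  rewrite mul0r expR0 mulr1 /potential.
  under eq_bigr => i _.
    rewrite /weight /total_load /set_load /= big1 // mul0r mulr0 expR0.
    over.
  by rewrite sumr_const card_ord.
apply: le_trans (potential_step _) _.
rewrite -[t.+1%:R]natr1 [(_ + 1) * _]mulrDl mul1r expRD mulrA.
by rewrite ler_pM2r ?expR_gt0.
Qed.

(** One weight is at most the potential, so taking logarithms bounds [eta] times the relative load
    by [L + T eta (1 + 7 eta)]. As [T eta = 2 E L], the claim reduces to
    [1 + 2E + 7/8 <= 2E + 2]. *)
Lemma total_load_counts L i : n%:R <= expR (L%:R : R) ->
  let T := (32 * E ^ 2 * L)%N in
  (total_load (counts T) i)%:R
    <= T%:R * (1 + E%:R^-1) * (frequency S i)%:R :> R.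
Proof.
move=> n_le /=; set T := (32 * _ * _)%N; have eta0 := eta_gt0.
rewrite -ler_pdivrMr ?ltr0n ?freq_gt0 //.
have := le_trans (weight_le_potential _ _ i) (potential_counts T).
move=> /le_trans/(_ (ler_wpM2r (expR_ge0 _) n_le)).
rewrite -expRD ler_expR; set r := _ / _ => load_le.
have -> : r = (eta * r) * (16 * E)%:R.
  by rewrite /eta mulrAC mulVf ?mul1r // pnatr_eq0 muln_eq0 /= -lt0n.
rewrite -ler_pdivlMr ?ltr0n ?muln_gt0 //; apply: le_trans load_le _.
have E1 : 1 <= E%:R :> R by rewrite ler1n.
rewrite /T /eta !natrM.
have -> : L%:R + 32 * (E%:R * E%:R) * L%:R *
    ((16 * E%:R)^-1 * (1 + 7 * (16 * E%:R)^-1)) =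
  L%:R * (1 + 2 * E%:R + 7 / 8) :> R by field; lra.
have -> : 32 * (E%:R * E%:R) * L%:R * (1 + E%:R^-1) / (16 * E%:R)
  = L%:R * (2 * E%:R + 2) :> R by field; lra.
by rewrite ler_wpM2l //; lra.
Qed.

(** * Bounds and totals of the counters *)

Lemma counts1_le t i : ((counts t).1 i <= t)%N.
Proof. by elim: t => //= t IHt; rewrite -addn1 leq_add // leq_b1. Qed.

Lemma counts2_le t j : ((counts t).2 j <= t)%N.
Proof. by elim: t => //= t IHt; rewrite -addn1 leq_add // leq_b1. Qed.

Lemma sum_counts1 t : (t * opt_coverage S k <= \sum_i (counts t).1 i)%N.
Proof.
elim: t => [|t IHt] /=; first by rewrite mul0n.
by rewrite big_split sum_mem mulSn addnC leq_add ?opt_le_response.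
Qed.

Lemma sum_counts2 t : (\sum_j (counts t).2 j = t * (m - k))%N.
Proof.
elim: t => [|t IHt] /=; first by rewrite big1.
by rewrite big_split IHt sum_mem card_response2 mulSn addnC.
Qed.

End MultiplicativeWeights.

(** * Bit-level programs from typed ones *)

Section BitCode.
Variables (T : finType) (w : nat).

(** A fixed-length code, injective once [T] has at most [2 ^ w] elements; the default of [nth] is
    reached only beyond that. *)
Definition encode (x : T) : seq bool :=
  nth [tuple of nseq w false] (enum {: w.-tuple bool}) (enum_rank x).

Definition decode (x0 : T) (s : seq bool) : T :=
  odflt x0 [pick x | encode x == s].

Lemma size_encode x : size (encode x) = w.
Proof. exact: size_tuple. Qed.

Lemma encodeK x0 : (#|T| <= 2 ^ w)%N -> cancel encode (decode x0).
Proof.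
move=> cardT x; rewrite /decode.
case: pickP => [y /eqP|/(_ x)]; last by rewrite eqxx.
have rank_lt (z : T) : (enum_rank z < size (enum {: w.-tuple bool}))%N.
  by rewrite -cardE card_tuple card_bool; apply: leq_trans cardT.
move=> /val_inj/eqP; rewrite nth_uniq ?rank_lt ?enum_uniq // => /eqP/val_inj.
exact: enum_rank_inj.
Qed.

End BitCode.

Section TypedProtocol.
Variables (R : realType) (n m : nat) (State Msg : finType).
Variables (state_bits msg_bits : nat) (msg0 : Msg) (nrounds : nat).
Variables (init : {set 'I_n} -> State).
Variables (tsend : nat -> 'I_m -> State -> 'I_m -> Msg).
Variables (tupdate : nat -> 'I_m -> State -> ('I_m -> Msg) -> State).
Variables (output_x : State -> 'I_n -> R) (output_z : State -> 'I_m -> R).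

(* The initial memory is not a code word but the characteristic vector of the
   input set. *)
Definition read_state (t : nat) (s : seq bool) : State :=
  if t is 0 then init [set i : 'I_n | nth false s i]
  else decode state_bits (init set0) s.

(** Every message has the full length [msg_bits], so the traffic is constant over the rounds, and
    every machine reports every coordinate. *)
Definition compile : mpc_algorithm R n m := MPCAlgorithm nrounds
  (fun t j s l => encode msg_bits (tsend t j (read_state t s) l))
  (fun t j s inbox => encode state_bits
     (tupdate t j (read_state t s) (fun l => decode msg_bits msg0 (inbox l))))
  (fun j s i => Some (output_x (read_state nrounds s) i))
  (fun j s i => Some (output_z (read_state nrounds s) i)).

Fixpoint typed_run (S : 'I_m -> {set 'I_n}) (t : nat) : 'I_m -> State :=
  if t is t'.+1 then
    fun j => tupdate t' j (typed_run S t' j)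
               (fun l => tsend t' l (typed_run S t' l) j)
  else fun j => init (S j).

Hypotheses (state_fits : (#|State| <= 2 ^ state_bits)%N).
Hypotheses (msg_fits : (#|Msg| <= 2 ^ msg_bits)%N).
Variable S : 'I_m -> {set 'I_n}.

Lemma read_state_memory t j :
  read_state t (memory compile S t j) = typed_run S t j.
Proof.
elim: t j => [|t IHt] j /=.
  congr init; apply/setP => i; rewrite inE (nth_map i) ?size_enum_ord //.
  by rewrite nth_ord_enum.
rewrite encodeK // IHt; congr tupdate; apply/funext => l.
by rewrite encodeK // IHt.
Qed.

Lemma compile_capacity (B : R) :
  n%:R <= B -> state_bits%:R <= B -> (m * msg_bits)%:R <= B ->
  respects_capacity compile S B.
Proof.
move=> n_le state_le msg_le; split=> [[|t] j _ | t j _].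
- by rewrite size_map size_enum_ord.
- by rewrite size_encode.
- rewrite /received; under eq_bigr do rewrite size_encode.
  by rewrite sum_nat_const card_ord.
Qed.

Lemma compile_outputs (x : 'rV[R]_n) (z : 'rV[R]_m) : (0 < m)%N ->
  (forall j i, output_x (typed_run S nrounds j) i = x 0 i) ->
  (forall j i, output_z (typed_run S nrounds j) i = z 0 i) ->
  outputs compile S x z.
Proof.
move=> m_gt0 xE zE; split=> [i|j i v|i|j i v] /=.
- by exists (Ordinal m_gt0); rewrite read_state_memory xE.
- by rewrite read_state_memory xE => -[].
- by exists (Ordinal m_gt0); rewrite read_state_memory zE.
- by rewrite read_state_memory zE => -[].
Qed.

End TypedProtocol.

(** * The coverage protocol *)

Section CoverageProtocol.
Variables (R : realType) (n m k E b : nat).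

(** The form [.-1.+1] exhibits the successor that [inord] requires; the type has [2 ^ b]
    elements. *)
Definition word := 'I_((2 ^ b).-1.+1).
Definition to_word (v : nat) : word := inord v.

(* The element [i] of ['I_n] is the number [i %/ m] of those that machine
   [i %% m] owns. *)
Definition slot := 'I_((n %/ m).+1).
Definition owned (l : 'I_m) (r : slot) : option 'I_n := insub (r * m + l)%N.
Definition owns_in (D : {set 'I_n}) (l : 'I_m) (r : slot) : bool :=
  if owned l r is Some i then i \in D else false.
Definition owner (j0 : 'I_m) (i : 'I_n) : 'I_m := insubd j0 (i %% m)%N.
Definition slot_of (i : 'I_n) : slot := inord (i %/ m).

(** One type for all rounds: an entry carries a membership bit, a set load with a frequency, or a
    score repeated in every slot. *)
Definition message := {ffun slot -> word * word}.
Definition no_message : message := [ffun=> (to_word 0, to_word 0)].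

Definition input := ({set 'I_n} * {ffun slot -> {set 'I_m}})%type.
Definition counters := ({ffun 'I_n -> word} * {ffun 'I_m -> word})%type.
(** Per element, the set load and the frequency last broadcast by its owner. *)
Definition stats := {ffun 'I_n -> word * word}.
Definition state := (input * counters * stats)%type.

Definition own_set (s : state) := s.1.1.1.
Definition columns (s : state) := s.1.1.2.
Definition count_x (s : state) i : nat := s.1.2.1 i.
Definition count_z (s : state) j : nat := s.1.2.2 j.
Definition known_load (s : state) i : nat := (count_x s i + (s.2 i).1)%N.
Definition known_frequency (s : state) i : nat := (s.2 i).2.

Definition words (I : finType) (v : I -> nat) : {ffun I -> word} :=
  [ffun i => to_word (v i)].

Definition init_state (D : {set 'I_n}) : state :=
  ((D, [ffun=> set0]), (words (fun=> 0%N), words (fun=> 0%N)),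
   [ffun=> (to_word 0, to_word 0)]).

Definition send_columns (s : state) (l : 'I_m) : message :=
  [ffun r => (to_word (owns_in (own_set s) l r), to_word 0)].

Definition send_stats (s : state) : message :=
  [ffun r => (to_word (\sum_(j in columns s r) count_z s j),
              to_word #|columns s r|)].

Definition send_score (s : state) : message :=
  [ffun=> (to_word (score R m E (known_frequency s) (known_load s) (own_set s)),
           to_word 0)].

(** Round 0 distributes the incidence matrix by elements; rounds [2t + 1] and [2t + 2] carry the
    loads and the scores of iteration [t]. *)
Definition protocol_send (t : nat) (j : 'I_m) (s : state) (l : 'I_m) :
    message :=
  if t == 0%N then send_columns s l
  else if odd t then send_stats s else send_score s.

Definition protocol_update (t : nat) (j : 'I_m) (s : state)
    (inbox : 'I_m -> message) : state :=
  if t == 0%N then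
    ((own_set s, [ffun r => [set l | (inbox l r).1 == 1%N :> nat]]), s.1.2, s.2)
  else if odd t then
    (s.1.1, s.1.2, [ffun i => inbox (owner j i) (slot_of i)])
  else
    let w := best_response R k E (known_frequency s) (known_load s)
               (fun l => (inbox l ord0).1) in
    (s.1.1, (words (fun i => count_x s i + (i \in w.1)),
             words (fun l => count_z s l + (l \in w.2)))%N, s.2).

Lemma card_word : #|{: word}| = (2 ^ b)%N.
Proof. by rewrite card_ord prednK ?expn_gt0. Qed.

Lemma card_message : #|{: message}| = (2 ^ (2 * b * (n %/ m).+1))%N.
Proof.
by rewrite card_ffun card_prod card_word -expnD addnn -mul2n card_ord -expnM.
Qed.

Lemma card_state : #|{: state}| =
  (2 ^ (n + m * (n %/ m).+1 + (b * n + b * m) + 2 * b * n))%N.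
Proof.
rewrite !card_prod !card_ffun !card_prod !card_word !card_ord -!cardsT.
(* The set types are counted as powersets of full sets. *)
rewrite -!powersetT !card_powerset !cardsT !card_ord.
by rewrite -(expnD 2 b b) -!expnM -!expnD addnn -mul2n.
Qed.

Lemma to_wordK v : (v < 2 ^ b)%N -> to_word v = v :> nat.
Proof. by move=> v_lt; rewrite inordK // prednK ?expn_gt0. Qed.

(** * Invariant of the execution *)

Variable S : 'I_m -> {set 'I_n}.

Definition run := typed_run init_state protocol_send protocol_update S.

Arguments run : simpl never.

Lemma runS t j :
  run t.+1 j = protocol_update t j (run t j)
                 (fun l => protocol_send t l (run t l) j).
Proof. by []. Qed.

Definition all_columns (l : 'I_m) : {ffun slot -> {set 'I_m}} :=
  [ffun r => [set j | owns_in (S j) l r]].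

(** The component [s.2] is left out because, once the counters advance, it is out of date until the
    next broadcast of loads. *)
Definition replicated (t : nat) (s : state) (j : 'I_m) : Prop :=
  s.1 = ((S j, all_columns j),
         (words (counts R k E S t).1, words (counts R k E S t).2)).

Definition all_stats (t : nat) : stats :=
  [ffun i => (to_word (set_load S (counts R k E S t).2 i),
              to_word (frequency S i))].

Lemma ownedK (j : 'I_m) i : owned (owner j i) (slot_of i) = Some i.
Proof.
have m_gt0 : (0 < m)%N by apply: leq_trans (ltn_ord j).
rewrite /owned /owner /slot_of inordK ?ltnS ?leq_div2r ?(ltnW (ltn_ord i)) //.
rewrite val_insubd ltn_pmod // -divn_eq.
by rewrite insubT // => i_lt; congr Some; apply: val_inj.
Qed.

Variable T : nat.
Hypotheses (m_gt0 : (0 < m)%N) (n_gt0 : (0 < n)%N) (E_gt0 : (0 < E)%N).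
Hypothesis freq_gt0 : forall i, (0 < frequency S i)%N.
Hypotheses (T_gt0 : (0 < T)%N) (load_fits : (m * T < 2 ^ b)%N).
Hypothesis score_fits : (score_scale m E < 2 ^ b)%N.

Local Notation counts t := (counts R k E S t).

Lemma bit_word (x : bool) : (to_word x == 1%N :> nat) = x.
Proof.
rewrite to_wordK; first by case: x.
apply: leq_ltn_trans load_fits; apply: leq_trans (leq_b1 x) _.
by rewrite muln_gt0 m_gt0.
Qed.

Lemma words_counts1 t : (t <= T)%N ->
  (fun i => words (counts t).1 i : nat) = (counts t).1.
Proof.
move=> tT; apply/funext => i; rewrite ffunE to_wordK //.
apply: leq_ltn_trans load_fits; apply: leq_trans (counts1_le _ _ _ _ _ _) _.
by rewrite (leq_trans tT) // leq_pmull.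
Qed.

Lemma words_counts2 t : (t <= T)%N ->
  (fun j => words (counts t).2 j : nat) = (counts t).2.
Proof.
move=> tT; apply/funext => i; rewrite ffunE to_wordK //.
apply: leq_ltn_trans load_fits; apply: leq_trans (counts2_le _ _ _ _ _ _) _.
by rewrite (leq_trans tT) // leq_pmull.
Qed.

Lemma all_stats_load t i : (t <= T)%N ->
  (all_stats t i).1 = set_load S (counts t).2 i :> nat.
Proof.
move=> tT; rewrite ffunE to_wordK //; apply: leq_ltn_trans load_fits.
apply: (@leq_trans (\sum_(j < m) T)); last by rewrite sum_nat_const card_ord.
rewrite /set_load big_mkcond; apply: leq_sum => j _; case: ifP => // _.
exact: leq_trans (counts2_le _ _ _ _ _ _) tT.
Qed.

Lemma all_stats_frequency t i : (all_stats t i).2 = frequency S i :> nat.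
Proof.
rewrite ffunE to_wordK //; apply: leq_ltn_trans load_fits.
by rewrite (leq_trans (max_card _)) // card_ord leq_pmulr.
Qed.

Lemma scores_fit t j :
  (score R m E (frequency S) (total_load S (counts t)) (S j) < 2 ^ b)%N.
Proof.
by apply: leq_ltn_trans score_fits; apply: score_le_scale.
Qed.

Section Replicated.
Variables (t : nat) (s : state) (j : 'I_m).
Hypotheses (tT : (t <= T)%N) (rep : replicated t s j).

Lemma replicated_own_set : own_set s = S j.
Proof. by rewrite /own_set rep. Qed.

Lemma replicated_columns : columns s = all_columns j.
Proof. by rewrite /columns rep. Qed.

Lemma replicated_count_x : count_x s = (counts t).1.
Proof.
by rewrite -words_counts1 //; apply/funext => i; rewrite /count_x rep.
Qed.

Lemma replicated_count_z : count_z s = (counts t).2.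
Proof.
by rewrite -words_counts2 //; apply/funext => i; rewrite /count_z rep.
Qed.

Hypothesis s_stats : s.2 = all_stats t.

Lemma replicated_load : known_load s = total_load S (counts t).
Proof.
apply/funext => i.
by rewrite /known_load replicated_count_x s_stats all_stats_load.
Qed.

Lemma replicated_frequency : known_frequency s = frequency S.
Proof.
by apply/funext => i; rewrite /known_frequency s_stats all_stats_frequency.
Qed.

End Replicated.

Lemma replicated_run1 j : replicated 0 (run 1 j) j.
Proof.
rewrite /replicated /run /= /protocol_update /protocol_send /=.
congr ((_, _), (_, _)).
apply/ffunP => r; rewrite !ffunE; apply/setP => l; rewrite !inE !ffunE /=.
exact: bit_word.
Qed.

Lemma replicated_odd_round t : (t <= T)%N ->
  (forall j, replicated t (run t.*2.+1 j) j) ->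
  forall j, replicated t (run t.*2.+2 j) j /\ (run t.*2.+2 j).2 = all_stats t.
Proof.
move=> tT rep j.
rewrite runS /protocol_update /protocol_send /= odd_double /=.
split; first by rewrite /replicated /= -surjective_pairing; apply: rep.
apply/ffunP => i; rewrite !ffunE.
rewrite (replicated_columns (rep _)) (replicated_count_z tT (rep _)).
(* The owner of [i] knows all sets containing [i], so its local sum and cardinality are the true set
   load and frequency. *)
have -> : all_columns (owner j i) (slot_of i) = [set l | i \in S l].
  by rewrite ffunE; apply/setP => l; rewrite !inE /owns_in ownedK.
congr (to_word _, _).
by apply: eq_bigl => l; rewrite inE.
Qed.

Lemma replicated_even_round t : (t < T)%N ->
  (forall j, replicated t (run t.*2.+2 j) j /\
             (run t.*2.+2 j).2 = all_stats t) ->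
  forall j, replicated t.+1 (run t.+1.*2.+1 j) j.
Proof.
move=> tT rep j; have tT' := ltnW tT.
rewrite doubleS runS /protocol_update /protocol_send /= odd_double /=.
have [rep_j stats_j] := rep j.
rewrite (replicated_load tT' rep_j stats_j) (replicated_frequency stats_j).
rewrite (replicated_count_x tT' rep_j) (replicated_count_z tT' rep_j).
rewrite /replicated /=; congr (_, _); first by rewrite rep_j.
have -> : (fun l => (send_score (run t.*2.+2 l) ord0).1 : nat)
  = (fun l => score R m E (frequency S) (total_load S (counts t)) (S l)).
  apply/funext => l; have [rep_l stats_l] := rep l; rewrite ffunE /=.
  rewrite (replicated_load tT' rep_l stats_l) (replicated_frequency stats_l).
  by rewrite (replicated_own_set rep_l) to_wordK // scores_fit.
by [].
Qed.

(** The initial exchange and two rounds per iteration account for [2t + 1]. *)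
Lemma replicated_run t j : (t <= T)%N -> replicated t (run t.*2.+1 j) j.
Proof.
move=> tT; elim: t tT j => [|t IHt] tT j; first exact: replicated_run1.
apply: replicated_even_round => // {}j; apply: replicated_odd_round => [|{}j].
  exact: ltnW.
by apply: IHt; apply: ltnW.
Qed.

End CoverageProtocol.

(** * Choice of the parameters *)

Section Tuning.
Variables (R : realType) (n m k : nat) (eps : R).

(** For [eps] in (0,1), an integer above [1 / eps] and at most [2 / eps]. *)
Definition precision : nat := (Num.trunc eps^-1).+1.
(** The count of [total_load_counts] for [L = trunc_log 2 n + 1], chosen so that
    [n < 2 ^ L <= e ^ L]. *)
Definition iterations : nat :=
  (32 * precision ^ 2 * (trunc_log 2 n).+1)%N.
(** Makes [2 ^ word_bits] exceed [(2 n precision)^6], which dominates both the set loads and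
    [score_scale]. *)
Definition word_bits : nat := (6 * (trunc_log 2 (2 * n * precision)).+1)%N.
Definition state_bits : nat :=
  (n + m * (n %/ m).+1 + (word_bits * n + word_bits * m)
   + 2 * word_bits * n)%N.
Definition message_bits : nat := (2 * word_bits * (n %/ m).+1)%N.

Definition coverage_mpc : mpc_algorithm R n m :=
  compile state_bits message_bits (no_message n m word_bits) (iterations.*2.+1)
    (@init_state n m word_bits)
    (@protocol_send R n m precision word_bits)
    (@protocol_update R n m k precision word_bits)
    (fun s i => (count_x s i)%:R / iterations%:R)
    (fun s j => (count_z s j)%:R / iterations%:R).

(* For [m = 1] the bound on the rounds is [0]; the only set is then [n]. *)
Definition single_set_mpc : mpc_algorithm R n m := MPCAlgorithm 0
  (fun _ _ _ _ => [::]) (fun _ _ s _ => s)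
  (fun _ _ _ => Some k%:R) (fun _ _ _ => Some (1 - k%:R)).

Lemma word_bits_large v :
  (0 < n)%N -> (v <= (2 * n * precision) ^ 6)%N -> (v < 2 ^ word_bits)%N.
Proof.
move=> n_gt0 /leq_ltn_trans; apply.
by rewrite /word_bits [(6 * _)%N]mulnC expnM ltn_exp2r // trunc_log_ltn.
Qed.

Lemma load_fits : (0 < n)%N -> (m <= n)%N -> (m * iterations < 2 ^ word_bits)%N.
Proof.
move=> n_gt0 m_le_n; apply: word_bits_large => //.
have log_lt : ((trunc_log 2 n).+1 <= n)%N.
  by apply: leq_trans (ltn_expl _ (ltnSn 1)) _; apply: trunc_logP.
apply: (@leq_trans (n * (32 * precision ^ 2 * n))).
  by rewrite /iterations !leq_mul.
rewrite !expnMn.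
have : (n ^ 2 <= n ^ 6)%N by rewrite leq_pexp2l.
have : (precision ^ 2 <= precision ^ 6)%N by rewrite leq_pexp2l.
move: (precision ^ 6)%N (n ^ 6)%N (precision ^ 2)%N => a c d da.
rewrite -mulnn => nc.
apply: (@leq_trans (32 * (n * n * d))); first by apply: eq_leq; ring.
by rewrite -[leqRHS]mulnA !leq_mul.
Qed.

Lemma score_fits : (0 < n)%N -> (m <= n)%N ->
  (score_scale m precision < 2 ^ word_bits)%N.
Proof.
move=> n_gt0 m_le_n; apply: word_bits_large => //; rewrite !expnMn.
rewrite /score_scale !leq_mul //.
  by apply: leq_trans m_le_n _; rewrite -{1}(expn1 n) leq_pexp2l.
by rewrite -{1}(expn1 precision) leq_pexp2l.
Qed.

(** Expanding gives terms amounting to seven copies of at most [word_bits * n], as [m] and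
    [m * (n %/ m)] are at most [n]. *)
Lemma state_bits_le : (0 < m)%N -> (m <= n)%N ->
  (state_bits <= 7 * word_bits * n)%N.
Proof.
move=> m_gt0 m_le_n; rewrite /state_bits.
have : (m * (n %/ m) <= n)%N by rewrite mulnC leq_trunc_div.
have : (0 < word_bits)%N by [].
rewrite mulnS; move: (m * (n %/ m))%N => a; nia.
Qed.

Lemma message_bits_le : (0 < m)%N -> (m <= n)%N ->
  (m * message_bits <= 7 * word_bits * n)%N.
Proof.
move=> m_gt0 m_le_n; rewrite /message_bits mulnCA mulnS.
have : (m * (n %/ m) <= n)%N by rewrite mulnC leq_trunc_div.
have : (0 < word_bits)%N by [].
move: (m * (n %/ m))%N => a; nia.
Qed.

Hypothesis eps01 : 0 < eps < 1.

Lemma invr_precision_le : precision%:R^-1 <= eps.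
Proof.
have /andP[eps_gt0 _] := eps01.
rewrite invf_ple ?posrE ?ltr0n //; exact/ltW/truncnS_gt.
Qed.

Lemma precision_le : precision%:R <= 2 / eps.
Proof.
have /andP[eps_gt0 eps_lt1] := eps01.
have : (Num.trunc eps^-1)%:R <= eps^-1 by rewrite truncn_le invr_ge0 ltW.
have : 1 <= eps^-1 by rewrite invf_ge1 // ltW.
by rewrite /precision -[_.+1%:R]natr1; lra.
Qed.

Lemma ln2_gt0 : 0 < ln (2 : R).
Proof. by rewrite ln_gt0 // ltr1n. Qed.

Lemma ln2_le1 : ln (2 : R) <= 1.
Proof. by have /= := @le_ln1Dx R 1; apply; rewrite (lt_trans (ltrN10 R)). Qed.

Lemma ln2_trunc_log v : (0 < v)%N -> (trunc_log 2 v)%:R * ln 2 <= ln v%:R :> R.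
Proof.
move=> v_gt0; rewrite mulrC mulr_natr -lnXn //.
rewrite ler_ln ?posrE ?exprn_gt0 ?ltr0n //.
by rewrite -natrX ler_nat trunc_logP.
Qed.

Lemma ln2_succ_trunc_log v : (1 < v)%N ->
  ((trunc_log 2 v).+1)%:R * ln 2 <= 2 * ln v%:R :> R.
Proof.
move=> v_gt1; have v_gt0 : (0 < v)%N by apply: ltnW.
apply: (@le_trans _ _ (2 * ((trunc_log 2 v)%:R * ln 2))).
  rewrite mulrA -natrM ler_wpM2r ?(ltW ln2_gt0) // ler_nat mul2n -addnn.
  by rewrite -addn1 leq_add2l trunc_log_gt0.
by rewrite ler_pM2l // ln2_trunc_log.
Qed.

(** The count is of order [eps^-2 ln n]; the other two factors, [eps^-1] and [ln m / ln 2], are at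
    least 1. *)
Lemma iterations_le : (1 < n)%N -> (1 < m)%N ->
  (iterations.*2.+1)%:R <=
    1000 * ln 2 ^- 2 * eps ^- 3 * ln n%:R * ln m%:R :> R.
Proof.
move=> n_gt1 m_gt1; have /andP[eps_gt0 eps_lt1] := eps01.
have l2 := ln2_gt0.
have m_ge : ln 2 <= ln m%:R :> R.
  by rewrite ler_ln ?posrE ?ltr0n ?ler_nat // ltnW.
have n_ge := ln2_succ_trunc_log n_gt1.
have p_le := precision_le.
have p_ge1 : 1 <= precision%:R :> R by rewrite ler1n.
have inv_eps : 1 <= eps^-1 by rewrite invf_ge1 // ltW.
pose l : R := (trunc_log 2 n).+1%:R.
have l_ge1 : 1 <= l by rewrite ler1n.
(* Twice the 32 of [iterations], plus one for the initial round; below, 520 is [65 * 4 * 2]. *)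
apply: (@le_trans _ _ (65 * precision%:R ^+ 2 * l)).
  rewrite -natr1 -mul2n natrM /iterations !natrM -/l -expr2.
  have : 1 <= precision%:R ^+ 2 :> R by rewrite exprn_ege1.
  nra.
have p2_le : precision%:R ^+ 2 <= 4 * eps^-1 ^+ 2.
  have -> : 4 * eps^-1 ^+ 2 = (2 / eps) ^+ 2 by field; rewrite gt_eqF.
  by rewrite ler_pXn2r ?nnegrE //; lra.
have l_le : l <= 2 * ln n%:R / ln 2 by rewrite ler_pdivlMr.
have m_le : 1 <= ln m%:R / ln 2 :> R by rewrite ler_pdivlMr // mul1r.
have ln_n : 0 <= ln n%:R :> R by rewrite ln_ge0 // ler1n ltnW.
apply: (@le_trans _ _ (65 * (4 * eps^-1 ^+ 2) * (2 * ln n%:R / ln 2))).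
  by rewrite ler_pM ?mulr_ge0 ?exprn_ge0 ?ler_pM2l // ler0n.
rewrite (_ : 1000 * _ * _ * _ * _ =
  (1000 * eps^-1 ^+ 2 * (ln n%:R / ln 2)) * (eps^-1 * (ln m%:R / ln 2)));
  last first.
  by field; rewrite !gt_eqF.
rewrite (_ : 65 * _ * _ = 520 * eps^-1 ^+ 2 * (ln n%:R / ln 2)); last first.
  by field; rewrite !gt_eqF.
have a_ge0 : 0 <= eps^-1 ^+ 2 * (ln n%:R / ln 2).
  by rewrite mulr_ge0 ?divr_ge0 ?exprn_ge0 //; lra.
rewrite -!(mulrA _ (eps^-1 ^+ 2)) in a_ge0 *.
have : 1 <= eps^-1 * (ln m%:R / ln 2) by rewrite mulr_ege1.
nra.
Qed.

Lemma ln_word_ge : (0 < n)%N -> ln 2 <= ln (2 * n%:R / eps) :> R.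
Proof.
move=> n_gt0; have /andP[eps_gt0 eps_lt1] := eps01.
have n1 : 1 <= n%:R :> R by rewrite ler1n.
rewrite ler_ln ?posrE ?divr_gt0 ?mulr_gt0 ?ltr0n //.
by rewrite ler_pdivlMr //; nra.
Qed.

Lemma capacity_ge (v : nat) : (0 < n)%N -> (v <= 7 * word_bits * n)%N ->
  v%:R <= capacity (1000 * ln 2 ^- 2) 0 n eps.
Proof.
move=> n_gt0; rewrite -(ler_nat R) => /le_trans; apply.
have /andP[eps_gt0 eps_lt1] := eps01.
have l2 := ln2_gt0; have l2_le := ln2_le1; have lw := ln_word_ge n_gt0.
rewrite /capacity expr0 mulr1 !natrM [leRHS]mulrAC ler_wpM2r //.
set w := ln (2 * n%:R / eps) in lw *.
have nE : (1 < 2 * n * precision)%N.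
  by rewrite -mulnA mul2n -addnn (@leq_add 1 1) // muln_gt0 n_gt0.
have bits := ln2_succ_trunc_log nE.
(* As [precision <= 2 / eps], the left side is at most [ln 2 + w], and [ln 2 <= w]. *)
have ln_le : ln (2 * n * precision)%:R <= 2 * w.
  apply: (@le_trans _ _ (ln (2 * (2 * n%:R / eps)))).
    rewrite ler_ln ?posrE ?mulr_gt0 ?invr_gt0 ?ltr0n //; last exact: ltnW.
    rewrite !natrM mulrCA -!mulrA ler_pM2l // ler_pM2l ?ltr0n //.
    exact: precision_le.
  by rewrite lnM ?posrE ?divr_gt0 ?mulr_gt0 ?ltr0n // -/w; lra.
set M := (trunc_log _ _).+1%:R in bits *.
have M_le : M <= 4 * w / ln 2 by rewrite ler_pdivlMr //; lra.
(* A word has [6 M] bits and [M <= 4 w / ln 2], whence [168 = 7 * 6 * 4]. *)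
apply: (@le_trans _ _ (168 * w / ln 2)); first by move: M_le; lra.
have inv : 1 <= (ln 2)^-1 :> R by rewrite invf_ge1.
rewrite (_ : 1000 * _ * w = (1000 * w / ln 2) * (ln 2)^-1); last first.
  by field; rewrite gt_eqF.
have : 0 <= w / ln 2 by rewrite divr_ge0 //; lra.
by rewrite -!(mulrA _ w); nra.
Qed.

End Tuning.

(** * Guarantees of the averaged solution *)

Section CoverageCorrectness.
Variables (R : realType) (n m k : nat) (eps : R) (S : 'I_m -> {set 'I_n}).
Hypotheses (m_gt0 : (0 < m)%N) (m_le_n : (m <= n)%N) (k_le_m : (k <= m)%N).
Hypotheses (eps01 : 0 < eps < 1) (freq_gt0 : forall i, (0 < frequency S i)%N).

Let n_gt0 : (0 < n)%N := leq_trans m_gt0 m_le_n.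
Local Notation T := (iterations n eps).
Local Notation c := (counts R k (precision eps) S T).

Definition fractional_x : 'rV[R]_n := \row_i ((c.1 i)%:R / T%:R).
Definition fractional_z : 'rV[R]_m := \row_j ((c.2 j)%:R / T%:R).

Lemma iterations_gt0 : (0 : R) < T%:R.
Proof. by rewrite ltr0n !muln_gt0. Qed.

Lemma coverage_mpc_outputs :
  outputs (coverage_mpc n m k eps) S fractional_x fractional_z.
Proof.
have fits := load_fits eps n_gt0 m_le_n.
have rep j : replicated R k (precision eps) S T
    (run R k (precision eps) (word_bits n eps) S T.*2.+1 j) j.
  by apply: (@replicated_run _ _ _ _ _ _ _ T); rewrite ?muln_gt0 ?score_fits.
apply: compile_outputs => //.
- by rewrite card_state.
- by rewrite card_message.
- by move=> j i; rewrite mxE (replicated_count_x m_gt0 fits (leqnn T) (rep j)).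
- by move=> j i; rewrite mxE (replicated_count_z m_gt0 fits (leqnn T) (rep j)).
Qed.

Lemma coverage_mpc_capacity :
  respects_capacity (coverage_mpc n m k eps) S
    (capacity (1000 * ln 2 ^- 2) 0 n eps).
Proof.
apply: compile_capacity; rewrite ?card_state ?card_message //.
- by apply: capacity_ge => //; rewrite leq_pmull // !muln_gt0.
- by apply: capacity_ge => //; apply: state_bits_le.
- by apply: capacity_ge => //; apply: message_bits_le.
Qed.

Lemma fractional_x_itv i : 0 <= fractional_x 0 i <= 1.
Proof.
rewrite mxE divr_ge0 //= ler_pdivrMr ?iterations_gt0 // mul1r ler_nat.
exact: counts1_le.
Qed.

Lemma fractional_z_itv j : 0 <= fractional_z 0 j <= 1.
Proof.
rewrite mxE divr_ge0 //= ler_pdivrMr ?iterations_gt0 // mul1r ler_nat.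
exact: counts2_le.
Qed.

Lemma sum_fractional_x : (opt_coverage S k)%:R <= \sum_i fractional_x 0 i.
Proof.
under eq_bigr do rewrite mxE.
rewrite -mulr_suml -natr_sum ler_pdivlMr ?iterations_gt0 //.
rewrite -natrM ler_nat mulnC.
exact: sum_counts1.
Qed.

Lemma sum_fractional_z : \sum_j fractional_z 0 j = m%:R - k%:R.
Proof.
under eq_bigr do rewrite mxE.
rewrite -mulr_suml -natr_sum sum_counts2 // natrM mulrAC mulfV ?mul1r ?natrB //.
exact/lt0r_neq0/iterations_gt0.
Qed.

(** This is [total_load_counts] divided by the iteration count and the frequency, with
    [1 / precision <= eps]. *)
Lemma fractional_constraint i :
  fractional_x 0 i / (frequency S i)%:R
  + (frequency S i)%:R^-1 * (\sum_(j | i \in S j) fractional_z 0 j) <= 1 + eps.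
Proof.
have T_gt0 := iterations_gt0.
have n_le : n%:R <= expR ((trunc_log 2 n).+1%:R : R).
  rewrite -[X in expR X]mulr1 expRM_natl.
  apply: (@le_trans _ _ (2 ^+ (trunc_log 2 n).+1)).
    by rewrite -natrX ler_nat ltnW // trunc_log_ltn.
  by rewrite lerXn2r ?nnegrE ?expR_ge0 // (expR_ge1Dx 1).
have load_le : (total_load S c i)%:R
    <= T%:R * (1 + (precision eps)%:R^-1) * (frequency S i)%:R :> R.
  exact: total_load_counts.
under eq_bigr do rewrite mxE.
rewrite mxE -mulr_suml -natr_sum mulrC -mulrDr -mulrDl -natrD.
rewrite -/(set_load S c.2 i) -/(total_load S c i).
rewrite mulrC ler_pdivrMr ?ltr0n // ler_pdivrMr // [leRHS]mulrC mulrA.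
apply: le_trans load_le _; rewrite ler_wpM2r // ler_wpM2l //.
by rewrite lerD2l invr_precision_le.
Qed.

End CoverageCorrectness.

(** With one set all frequencies are 1, and the constants [k] and [1 - k] add up to 1 in constraint
    (3). With no set, positive frequencies leave no element either. *)
Lemma single_set_correct (R : realType) (n m k : nat) (eps : R)
    (S : 'I_m -> {set 'I_n}) :
  (m <= 1)%N -> (k <= m)%N -> 0 < eps < 1 ->
  (forall i, (0 < frequency S i)%N) ->
  exists (x : 'rV[R]_n) (z : 'rV[R]_m),
    [/\ outputs (single_set_mpc R n m k) S x z,
        (forall i, 0 <= x 0 i <= 1) /\ (forall j, 0 <= z 0 j <= 1),
        \sum_i x 0 i >= (1 - eps) * (opt_coverage S k)%:R,
        \sum_j z 0 j = m%:R - k%:R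
      & forall i : 'I_n,
          x 0 i / (frequency S i)%:R
          + (frequency S i)%:R^-1 * (\sum_(j | i \in S j) z 0 j)
          <= 1 + eps].
Proof.
move=> m_le1 k_le_m /andP[eps_gt0 eps_lt1] freq_gt0.
have k_le1 := leq_trans k_le_m m_le1.
have k_le1R : k%:R <= 1 :> R by rewrite (ler_nat R k 1).
have k_ge0 : 0 <= k%:R :> R by [].
exists (const_mx k%:R), (const_mx (1 - k%:R)); split.
- split=> [i|j i v|j|j i v] /=; rewrite ?mxE; try by case.
    by have /card_gt0P[j _] := freq_gt0 i; exists j.
  by exists j.
- by split=> ?; rewrite mxE //; lra.
- under eq_bigr do rewrite mxE.
  rewrite sumr_const card_ord.
  apply: (@le_trans _ _ (opt_coverage S k)%:R).
    by rewrite ler_piMl //; lra.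
  rewrite -mulrnA ler_nat; apply/bigmax_leqP => K /eqP cardK.
  case: k k_le1 cardK {k_le_m k_le1R k_ge0} => [|[|//]] _.
    by move/cards0_eq ->; rewrite big_set0 cards0.
  by rewrite mul1n => _; apply: leq_trans (max_card _) _; rewrite card_ord.
- under eq_bigr do rewrite mxE.
  rewrite sumr_const card_ord.
  case: m m_le1 k_le_m {S freq_gt0} => [|[|//]] _; last by rewrite mulr1n.
  by rewrite leqn0 => /eqP ->; rewrite mulr0n subrr.
- move=> i; have freq1 : frequency S i = 1%N.
    apply/eqP; rewrite eqn_leq freq_gt0 andbT.
    by rewrite (leq_trans (max_card _)) // card_ord.
  under eq_bigr do rewrite mxE.
  rewrite sumr_const -cardsE -/(frequency S i) freq1 mxE.
  by rewrite divr1 invr1 mul1r mulr1n; lra.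
Qed.

Theorem theorem2 (R : realType) :
  exists (C : R) (c : nat) (A : forall n m k : nat, R -> mpc_algorithm R n m),
    forall (n m k : nat) (eps : R) (S : 'I_m -> {set 'I_n}),
      (m <= n)%N -> (k <= m)%N -> 0 < eps < 1 ->
      (forall i : 'I_n, (1 <= frequency S i)%N) ->
      [/\ (rounds (A n m k eps))%:R <= C * eps ^- 3 * ln (n%:R : R) * ln (m%:R : R),
          respects_capacity (A n m k eps) S (capacity C c n eps)
        & exists (x : 'rV[R]_n) (z : 'rV[R]_m),
          [/\ outputs (A n m k eps) S x z,
              (forall i, 0 <= x 0 i <= 1) /\ (forall j, 0 <= z 0 j <= 1),
              \sum_i x 0 i >= (1 - eps) * (opt_coverage S k)%:R,
              \sum_j z 0 j = m%:R - k%:R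
            & forall i : 'I_n,
                x 0 i / (frequency S i)%:R
                + (frequency S i)%:R^-1 * (\sum_(j | i \in S j) z 0 j)
                <= 1 + eps]].
Proof.
(* One constant serves both the rounds and the capacity, the latter with exponent 0. *)
exists (1000 * ln 2 ^- 2), 0%N, (fun n m k eps =>
  if (1 < m)%N then coverage_mpc n m k eps else single_set_mpc R n m k).
move=> n m k eps S m_le_n k_le_m eps01 freq_gt0.
have [m_gt1|m_le1] := ltnP 1 m.
  have m_gt0 := ltnW m_gt1; have n_gt1 := leq_trans m_gt1 m_le_n.
  split; first exact: iterations_le.
    exact: coverage_mpc_capacity.
  exists (fractional_x k eps S), (fractional_z k eps S); split.
  - exact: coverage_mpc_outputs.
  - by split=> ?; [apply: fractional_x_itv|apply: fractional_z_itv].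
  - apply: (@le_trans _ _ (opt_coverage S k)%:R); last exact: sum_fractional_x.
    by rewrite ler_piMl //; have /andP[? ?] := eps01; lra.
  - exact: sum_fractional_z.
  - exact: fractional_constraint.
split; last exact: single_set_correct.
  (* The bound must be 0 here: [ln 1] vanishes, and [ln 0] is 0 by convention. *)
  case: m m_le1 {S m_le_n k_le_m freq_gt0} => [|[|//]] _ /=.
    by rewrite [ln 0%:R]ln0 ?mulr0.
  by rewrite ln1 mulr0.
split=> // t j _.
(* The existence of machine [j] forces [0 < m], hence [0 < n]. *)
have n_gt0 := leq_trans (leq_trans (ltn0Sn _) (ltn_ord j)) m_le_n.
apply: capacity_ge => //.
have -> : size (memory (single_set_mpc R n m k) S t j) = n.
  by elim: t => [|t IHt] //=; rewrite size_map size_enum_ord.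
by rewrite leq_pmull // !muln_gt0.
Qed.
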